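(* Let $n\ge3$, let $P$ be a positive-area local optimum, and fix a normalized KKT multiplier $\theta=(\lambda,\ell,r,d,u)$ at $P$. (1) There are at most eight pairwise internally disjoint, internally isolated positive two-terminal blocks. (2) For a fixed terminal pair $\{a,b\}$ and a fixed $\xi\in K_{\mathrm{sh}}(P)$, at most four pairwise internally disjoint, internally isolated positive two-terminal blocks with terminals $a,b$ can have nonzero flux.
   Context: A configuration is $P=(p_1,\dots,p_n)$ with $p_i=(x_i,y_i)\in[0,1]^2$. For a triple $t=(i,j,k)$, $i<j<k$, put $D_t(P)=\det(p_j-p_i,p_k-p_i)$, $A_t(P)=\tfrac12|D_t(P)|$, and $\delta(P)=\min_tA_t(P)$. A positive-area local optimum is a local maximizer $P$ of $\delta$ on $([0,1]^2)^n$ with $\Delta:=\delta(P)>0$. Put $s_t=\operatorname{sgn}D_t(P)$; near $P$, $A_t=\tfrac12s_tD_t$, which is used for derivatives. A normalized KKT multiplier at $P$ is a tuple $q=(\lambda,\ell,r,d,u)$ of nonnegative reals $\lambda_t$ (all triples $t$), $\ell_i,r_i,d_i,u_i$ ($i\in[n]$) with: $\lambda_t=0$ unless $A_t(P)=\Delta$; $\ell_i=0$ unless $x_i=0$, $r_i=0$ unless $x_i=1$, $d_i=0$ unless $y_i=0$, $u_i=0$ unless $y_i=1$; $\sum_t\lambda_t=1$; and $\sum_t\lambda_t\nabla_{p_i}A_t(P)+(\ell_i-r_i,d_i-u_i)=0$ for all $i$. Their set is $\mathcal K(P)$. For $t=(i,j,k)$, $i<j<k$, let $B_t=s_t(a_tc_t^T-c_ta_t^T)\in\mathbb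 R^{n\times n}$, $a_t=e_j-e_i$, $c_t=e_k-e_i$, and $B(q)=\sum_t\lambda_tB_t$. The shared kernel is $K_{\mathrm{sh}}(P)=\bigcap_{q\in\mathcal K(P)}\ker B(q)$. For the fixed multiplier, a triangle $t$ is positive if $\lambda_t>0$. A positive two-terminal block is a nonempty family $\mathcal H$ of positive triangles together with a partition of its vertex set $V(\mathcal H)=I\sqcup\{a,b\}$, $a\ne b$ ($I$ internal vertices, $a,b$ terminals). It is internally isolated if no positive triangle outside $\mathcal H$ contains a vertex of $I$. Blocks are pairwise internally disjoint if their internal vertex sets are pairwise disjoint. Put $B_{\mathcal H}=\sum_{t\in\mathcal H}\lambda_tB_t$. If $\xi\in K_{\mathrm{sh}}(P)$ satisfies $(B_{\mathcal H}\xi)_i=0$ for all $i\in I$ (automatic for internally isolated blocks), then $B_{\mathcal H}\xi=\rho(e_a-e_b)$ for a scalar $\rho$, the flux of $\mathcal H$ for $\xi$ (with respect to the terminals $a,b$). *)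

(* Defs.v *)
From mathcomp Require Import all_boot all_order all_algebra.
From mathcomp Require Import all_classical all_reals all_analysis.

Set Implicit Arguments.
Unset Strict Implicit.
Unset Printing Implicit Defensive.

Import Order.TTheory GRing.Theory Num.Theory.
Import numFieldNormedType.Exports.

Local Open Scope ring_scope.

Definition triple (n : nat) : Type :=
  {t : 'I_n * 'I_n * 'I_n | ((t.1.1 < t.1.2) && (t.1.2 < t.2))%N}.

Definition ti n (t : triple n) : 'I_n := (val t).1.1.
Definition tj n (t : triple n) : 'I_n := (val t).1.2.
Definition tk n (t : triple n) : 'I_n := (val t).2.

Definition vertices n (t : triple n) : {set 'I_n} := [set ti t; tj t; tk t]%SET.

Section Configurations.
Variables (R : realType) (n : nat).
Implicit Types (t : triple n) (xi : 'cV[R]_n).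

(* A configuration is an n x 2 matrix: row i is the point p_i, with
   x_i = P i 0 and y_i = P i 1. *)
Implicit Types P Q : 'M[R]_(n, 2).

Definition in_unit_square P : Prop := forall i c, 0 <= P i c <= 1.

Definition orient_det t P : R :=
  \det (col_mx (row (tj t) P - row (ti t) P) (row (tk t) P - row (ti t) P)
        : 'M[R]_2).

Definition area t P : R := 2^-1 * `|orient_det t P|.

(* For 3 <= n this infimum is a minimum, see [min_areaP]. *)
Definition min_area P : R := inf (range (area ^~ P)).

Lemma min_areaP P : (3 <= n)%N ->
  (exists t, min_area P = area t P) /\ (forall t, min_area P <= area t P).
Proof.
move=> n3.
have t0 : triple n.
  exists (Ordinal (ltn_trans (isT : 0 < 2)%N n3),
          Ordinal (ltn_trans (isT : 1 < 2)%N n3), Ordinal n3); exact: isT.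
case: (@Order.TotalTheory.arg_minP _ R (triple n) t0 predT (area ^~ P) isT).
move=> t _ tmin.
suff -> : min_area P = area t P by split; [exists t | move=> u; exact: tmin].
have lbt : lbound (range (area ^~ P)) (area t P) by move=> _ [u _ <-]; exact: tmin.
have tin : range (area ^~ P) (area t P) by exists t.
apply/eqP; rewrite eq_le; apply/andP; split.
  by apply: ge_inf => //; exists (area t P).
by apply: lb_le_inf => //; exists (area t P).
Qed.

Definition positive_local_optimum P : Prop :=
  [/\ in_unit_square P,
      \forall Q \near P, in_unit_square Q -> min_area Q <= min_area P
    & 0 < min_area P].

Definition orientation P t : R := Num.sg (orient_det t P).

(* Derivative at P of the smooth branch (1/2) s_t D_t, with s_t = sgn D_t(P)
   held fixed, in the coordinate c of the point p_i. *)
Definition partial_area P t (i : 'I_n) (c : 'I_2) : R :=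
  derive1 (fun h : R => 2^-1 * orientation P t
     * orient_det t (P + h *: delta_mx i c)) 0.

Record multiplier := Multiplier {
  lam : triple n -> R;
  mleft : 'I_n -> R;
  mright : 'I_n -> R;
  mdown : 'I_n -> R;
  mup : 'I_n -> R }.
Implicit Types q : multiplier.

Definition nonneg_multiplier q : Prop :=
  (forall t, 0 <= lam q t) /\
  (forall i, [/\ 0 <= mleft q i, 0 <= mright q i, 0 <= mdown q i
               & 0 <= mup q i]).

Definition complementary P q : Prop :=
  (forall t, area t P <> min_area P -> lam q t = 0) /\
  (forall i, [/\ P i 0 <> 0 -> mleft q i = 0, P i 0 <> 1 -> mright q i = 0,
                 P i 1 <> 0 -> mdown q i = 0 & P i 1 <> 1 -> mup q i = 0]).

Definition stationary P q : Prop := forall i,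
  \sum_(t : triple n) lam q t * partial_area P t i 0
    + (mleft q i - mright q i) = 0 /\
  \sum_(t : triple n) lam q t * partial_area P t i 1
    + (mdown q i - mup q i) = 0.

Definition KKT P : set multiplier := [set q |
  [/\ nonneg_multiplier q, complementary P q, \sum_(t : triple n) lam q t = 1
    & stationary P q]]%classic.

Definition basis_vec (i : 'I_n) : 'cV[R]_n := delta_mx i 0.

Definition Btri P t : 'M[R]_n :=
  let a := basis_vec (tj t) - basis_vec (ti t) in
  let c := basis_vec (tk t) - basis_vec (ti t) in
  orientation P t *: (a *m c^T - c *m a^T).

Definition Bmx P q : 'M[R]_n := \sum_(t : triple n) lam q t *: Btri P t.

Definition shared_kernel P : set 'cV[R]_n :=
  (\bigcap_(q in KKT P) [set xi | Bmx P q *m xi = 0])%classic.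

Record block := Block {
  triangles : {set triple n};
  internal : {set 'I_n};
  term1 : 'I_n;
  term2 : 'I_n }.
Implicit Types b : block.

Definition terminals b : {set 'I_n} := [set term1 b; term2 b]%SET.

Definition positive_block q b : Prop :=
  [/\ triangles b != finset.set0,
      forall t, t \in triangles b -> 0 < lam q t,
      term1 b != term2 b,
      [disjoint internal b & terminals b]
    & (\bigcup_(t in triangles b) vertices t)%SET
        = (internal b :|: terminals b)%SET].

Definition internally_isolated q b : Prop :=
  forall t, 0 < lam q t -> t \notin triangles b ->
    [disjoint vertices t & internal b].

Definition internally_disjoint m (F : 'I_m -> block) : Prop :=
  forall k l, k != l -> [disjoint internal (F k) & internal (F l)].

Definition Bblock P q b : 'M[R]_n :=
  \sum_(t in triangles b) lam q t *: Btri P t.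

(* For an internally isolated positive block and xi in the shared kernel, such
   a rho exists; it is unique since the two terminals are distinct. *)
Definition is_flux P q xi b (rho : R) : Prop :=
  Bblock P q b *m xi = rho *: (basis_vec (term1 b) - basis_vec (term2 b)).

Definition nonzero_flux P q xi b : Prop :=
  exists2 rho : R, is_flux P q xi b rho & rho != 0.

End Configurations.

(* Main.v *)
(** Write [M] for the matrix of a block with terminals [a], [b]. It is skew and
    its columns sum to zero. Stationarity says that [B(theta) y] and
    [B(theta) x] vanish at every vertex lying on no vertical, respectively no
    horizontal, side of the square. If [M v] and [M w] are both multiples of
    [e_a - e_b], then skewness forces [v^T M w = 0]. For [v = x], [w = y] this
    contradicts [x^T M y = 2 \sum_t lambda_t A_t > 0], so each block has an
    internal vertex on the boundary. For [v = y] (or [x]) and [w = xi] it gives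
    [rho (y_a - y_b) = 0], so when [y_a <> y_b] each block with nonzero flux has
    an internal vertex on a vertical side. No three points are collinear, so a
    side carries at most two vertices, whence the bounds 4 * 2 and 2 * 2. *)
Require Import Defs.
From mathcomp Require Import all_boot all_order all_algebra.
From mathcomp Require Import all_classical all_reals all_analysis.
From mathcomp Require Import ring.

Set Implicit Arguments.
Unset Strict Implicit.
Unset Printing Implicit Defensive.

Import Order.TTheory GRing.Theory Num.Theory.

Local Open Scope ring_scope.

(** * Skew bilinear forms and dipole vectors *)

Section SkewForms.
Variables (R : realType) (n : nat).
Implicit Types (M : 'M[R]_n) (v w z : 'cV[R]_n) (i a b : 'I_n).

Definition bform M v w : R := (v^T *m M *m w) 0 0.

Lemma bform_skew M v w : M^T = - M -> bform M v w = - bform M w v.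
Proof.
move=> skM; rewrite /bform -[v^T *m M *m w]trmxK mxE !trmx_mul trmxK skM.
by rewrite mulNmx mulmxN mxE mulmxA.
Qed.

Lemma bform_alt M v : M^T = - M -> bform M v v = 0.
Proof.
move=> /(bform_skew v v) /eqP.
by rewrite -addr_eq0 -mulr2n mulrn_eq0 /= => /eqP.
Qed.

Lemma bform_dipole M v w a b rho :
  M *m w = rho *: (basis_vec R a - basis_vec R b) ->
  bform M v w = rho * (v a 0 - v b 0).
Proof.
move=> Mw; rewrite /bform -mulmxA Mw -scalemxAr mulmxBr mxE mxE [X in _ + X]mxE.
by rewrite -!colE !mxE.
Qed.

(** Alternation gives [0 = w^T M w = beta (w_a - w_b)]. If [beta = 0], then [M w = 0]; if
    [w_a = w_b], then [w^T M v = alpha (w_a - w_b) = 0], and skewness exchanges the arguments. *)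
Lemma bform_dipole0 M v w a b alpha beta : M^T = - M ->
  M *m v = alpha *: (basis_vec R a - basis_vec R b) ->
  M *m w = beta *: (basis_vec R a - basis_vec R b) ->
  bform M v w = 0.
Proof.
move=> skM Mv Mw.
have := bform_alt w skM; rewrite (bform_dipole _ Mw) => /eqP.
rewrite mulf_eq0 => /orP[/eqP b0|/eqP wab].
  by rewrite (bform_dipole _ Mw) b0 mul0r.
by rewrite bform_skew // (bform_dipole _ Mv) wab mulr0 oppr0.
Qed.

End SkewForms.

(** * Triangle matrices, areas and their gradients *)

Lemma det2 (R : comPzRingType) (A : 'M[R]_2) :
  \det A = A 0 0 * A 1 1 - A 0 1 * A 1 0.
Proof.
rewrite (expand_det_row _ 0) !big_ord_recl big_ord0 /cofactor !det_mx11 !mxE.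
have -> : lift (0 : 'I_2) (0 : 'I_1) = 1 by apply: val_inj.
have -> : lift (1 : 'I_2) (0 : 'I_1) = 0 by apply: val_inj.
by rewrite addr0 /= expr0 mul1r expr1 mulN1r mulrN.
Qed.

Lemma col_mx2E0 (R : Type) m (u v : 'rV[R]_m) c :
  (col_mx u v : 'M[R]_(2, m)) 0 c = u 0 c.
Proof. by rewrite -(col_mxEu u v 0 c); congr (col_mx u v _ c); apply: val_inj. Qed.

Lemma col_mx2E1 (R : Type) m (u v : 'rV[R]_m) c :
  (col_mx u v : 'M[R]_(2, m)) 1 c = v 0 c.
Proof. by rewrite -(col_mxEd u v 0 c); congr (col_mx u v _ c); apply: val_inj. Qed.

Section Triangles.
Variables (R : realType) (n : nat).
Implicit Types (P Q : 'M[R]_(n, 2)) (t : triple n) (v w : 'cV[R]_n) (i : 'I_n).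

Lemma orient_detE t Q : orient_det t Q =
  (Q (tj t) 0 - Q (ti t) 0) * (Q (tk t) 1 - Q (ti t) 1)
  - (Q (tj t) 1 - Q (ti t) 1) * (Q (tk t) 0 - Q (ti t) 0).
Proof.
by rewrite /orient_det det2 !col_mx2E0 !col_mx2E1 !mxE.
Qed.

Lemma Btri_mulE P t w i : (Btri P t *m w) i 0 = orientation P t *
  (((i == tj t)%:R - (i == ti t)%:R) * (w (tk t) 0 - w (ti t) 0)
   - ((i == tk t)%:R - (i == ti t)%:R) * (w (tj t) 0 - w (ti t) 0)).
Proof.
have dotE (u v : 'I_n) :
    (basis_vec R u - basis_vec R v)^T *m w = (w u 0 - w v 0)%:M.
  rewrite linearB /= mulmxBl /basis_vec !trmx_delta -!rowE.
  by apply/matrixP => k l; rewrite !ord1 !mxE eqxx.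
rewrite /Btri -scalemxAl mulmxBl -!mulmxA !dotE !mul_mx_scalar !mxE !andbT.
by congr (_ * _); rewrite mulrC [X in _ - X]mulrC.
Qed.

Lemma Btri_skew P t : (Btri P t)^T = - Btri P t.
Proof.
by rewrite /Btri linearZ /= linearB /= !trmx_mul !trmxK -scalerN opprB.
Qed.

Lemma Btri_const P t (k : R) : Btri P t *m (const_mx k : 'cV_n) = 0.
Proof.
by apply/colP => i; rewrite Btri_mulE !mxE !subrr !mulr0 subrr mulr0.
Qed.

Lemma Btri_out P t w i : i \notin vertices t -> (Btri P t *m w) i 0 = 0.
Proof.
rewrite !inE !negb_or => /andP[/andP[/negPf iti /negPf itj] /negPf itk].
by rewrite Btri_mulE iti itj itk !subrr !mul0r subrr mulr0.
Qed.

(** Pairing [a_t] and [c_t] with [x] and [y] yields the edge coordinates, so [x^T (a c^T - c a^T) y]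
    is the determinant [D_t]; the factor [s_t] turns it into [|D_t|]. *)
Lemma Btri_area P t : bform (Btri P t) (col 0 P) (col 1 P) = 2 * area t P.
Proof.
have -> : 2 * area t P = orientation P t * orient_det t P.
  by rewrite /area mulrA divff ?pnatr_eq0 // mul1r normrEsg.
rewrite /bform -mulmxA mxE.
under eq_bigr do rewrite Btri_mulE mxE.
have pick (j : 'I_n) : \sum_i P i 0 * (i == j)%:R = P j 0.
  rewrite (bigD1 j) //= eqxx mulr1 big1 ?addr0 // => i /negPf ->.
  by rewrite mulr0.
rewrite orient_detE !mxE.
transitivity (orientation P t *
  ((\sum_i P i 0 * (i == tj t)%:R - \sum_i P i 0 * (i == ti t)%:R)
     * (P (tk t) 1 - P (ti t) 1)
   - (\sum_i P i 0 * (i == tk t)%:R - \sum_i P i 0 * (i == ti t)%:R)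
     * (P (tj t) 1 - P (ti t) 1))).
  rewrite -!sumrB !mulr_suml -sumrB mulr_sumr.
  by apply: eq_bigr => i _; rewrite !mxE; ring.
rewrite !pick; ring.
Qed.

(** [orient_det] is affine in each single coordinate, so partial derivatives are read off as slopes;
    [k] will be half the orientation. *)
Lemma derive1_affine (f : R -> R) (k c e : R) :
  (forall h, f h = k * (c + h * e)) -> derive1 f 0 = k * e.
Proof.
move=> fE; rewrite derive1E.
have -> : f = cst (k * c) + (k * e) *: (id : R -> R).
  by apply/funext => h; rewrite fE; transitivity (k * c + k * e * h); first by ring.
rewrite deriveD // derive_cst add0r deriveZ // derive_id.
by rewrite /GRing.scale /= mulr1.
Qed.

(** Translates gradients into matrix products: the x-gradient of [A_t] is half of [B_t y], and, in
    the next lemma, the y-gradient is minus half of [B_t x]. *)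
Lemma partial_area0 P t i :
  partial_area P t i 0 = 2^-1 * (Btri P t *m col 1 P) i 0.
Proof.
rewrite /partial_area Btri_mulE !mxE [RHS]mulrA.
apply: (derive1_affine (c := orient_det t P)) => h.
rewrite !orient_detE !mxE !eqxx !andbT !andbF /= ![_ == i]eq_sym.
ring.
Qed.

Lemma partial_area1 P t i :
  partial_area P t i 1 = - (2^-1 * (Btri P t *m col 0 P) i 0).
Proof.
rewrite /partial_area Btri_mulE !mxE [X in - X]mulrA -mulrN.
apply: (derive1_affine (c := orient_det t P)) => h.
rewrite !orient_detE !mxE !eqxx !andbT !andbF /= ![_ == i]eq_sym.
ring.
Qed.

End Triangles.

(** * General position of the points and vertices on the sides *)

Section NonCollinear.
Variables (R : realType) (n : nat) (n_ge3 : (3 <= n)%N) (P : 'M[R]_(n, 2)).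
Hypothesis P_pos : 0 < min_area P.
Implicit Types (i j k : 'I_n) (c : 'I_2).

Lemma area_gt0 t : 0 < area t P.
Proof. by have [_ /(_ t)] := min_areaP P n_ge3; exact: lt_le_trans. Qed.

(** The determinant [D] is invariant under cyclic rotation and odd under a swap, so the indices may
    be sorted; for increasing indices its absolute value is twice a positive area. *)
Lemma noncollinear i j k : i != j -> j != k -> k != i ->
  (P j 0 - P i 0) * (P k 1 - P i 1) != (P j 1 - P i 1) * (P k 0 - P i 0).
Proof.
pose D i j k :=
  (P j 0 - P i 0) * (P k 1 - P i 1) - (P j 1 - P i 1) * (P k 0 - P i 0).
suff D0 : i != j -> j != k -> k != i -> D i j k != 0.
  by move=> ij jk ki; rewrite -subr_eq0; exact: D0.
have Dlt (u v w : 'I_n) : (u < v)%N -> (v < w)%N -> D u v w != 0.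
  move=> uv vw; have uvw : ((u < v) && (v < w))%N by rewrite uv.
  have := area_gt0 (exist _ (u, v, w) uvw : triple n).
  rewrite /area orient_detE; apply: contraTneq; rewrite /D => /= ->.
  by rewrite normr0 mulr0 ltxx.
have Drot u v w : D v w u = D u v w by rewrite /D; ring.
have Dswap u v w : D v u w = - D u v w by rewrite /D; ring.
wlog ij : i j / (i < j)%N => [IH|].
  move=> ij jk ki; have [lij|lji|/val_inj eij] := ltngtP i j.
  - exact: IH.
  - by rewrite Dswap oppr_eq0 IH // eq_sym.
  - by rewrite eij eqxx in ij.
move=> _ jk ki; have [ljk|lkj|/val_inj ejk] := ltngtP j k.
- exact: Dlt.
- have [lki|lik|/val_inj eki] := ltngtP k i.
  + by rewrite (Drot k) Dlt.
  + by rewrite (Drot k) Dswap oppr_eq0 Dlt.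
  + by rewrite eki eqxx in ki.
- by rewrite ejk eqxx in jk.
Qed.

(** Two coincident points would be collinear with any third one, and [n >= 3] supplies a third
    index. *)
Lemma points_neq i j : i != j -> P i 0 = P j 0 -> P i 1 <> P j 1.
Proof.
move=> ij e0 e1.
have /card_gt0P[k] : (0 < #|~: [set i; j]|)%N.
  by rewrite -(ltn_add2l #|[set i; j]|) cardsC addn0 cards2 ij card_ord.
rewrite !inE negb_or => /andP[ki kj].
have jk : j != k by rewrite eq_sym.
by have := noncollinear ij jk ki; rewrite e0 e1 !subrr !mul0r eqxx.
Qed.

(** Vertices on the vertical sides for [c = 0], on the horizontal sides for [c = 1]. *)
Definition sides c : {set 'I_n} := [set i | (P i c == 0) || (P i c == 1)].

Lemma card_sides c : (#|sides c| <= 4)%N.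
Proof.
have card_line (s : R) : (#|[set i | P i c == s]| <= 2)%N.
  rewrite leqNgt; apply/negP => /card_gt2P[i [j [k [[]]]]].
  rewrite !inE => /eqP ic /eqP jc /eqP kc [ij jk ki].
  have := noncollinear ij jk ki.
  have [c0|c1] : c = 0 \/ c = 1.
    by case: c {ic jc kc} => -[|[|//]] lt_c; [left|right]; exact: val_inj.
  - by rewrite -c0 ic jc kc subrr mul0r mulr0 eqxx.
  - by rewrite -c1 ic jc kc subrr mul0r mulr0 eqxx.
have -> : sides c = [set i | P i c == 0] :|: [set i | P i c == 1].
  by apply/setP => i; rewrite !inE.
by apply: leq_trans (leq_card_setU _ _) (leq_add (card_line 0) (card_line 1)).
Qed.

End NonCollinear.

(** * Block matrices at a KKT multiplier *)

Section Blocks.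
Variables (R : realType) (n : nat) (P : 'M[R]_(n, 2)) (q : multiplier R n).
Hypothesis q_kkt : KKT P q.
Implicit Types (t : triple n) (v w : 'cV[R]_n) (i : 'I_n) (b : block n).

Lemma Bmx_mulE w i :
  (Bmx P q *m w) i 0 = \sum_t lam q t * (Btri P t *m w) i 0.
Proof.
rewrite /Bmx mulmx_suml summxE; apply: eq_bigr => t _.
by rewrite -scalemxAl mxE.
Qed.

Lemma Bblock_mulE b w i :
  (Bblock P q b *m w) i 0
    = \sum_(t in triangles b) lam q t * (Btri P t *m w) i 0.
Proof.
rewrite /Bblock mulmx_suml summxE; apply: eq_bigr => t _.
by rewrite -scalemxAl mxE.
Qed.

(** Off the vertical sides complementarity kills [mleft] and [mright], so x-stationarity reduces to
    half of [B(q) y] being zero at [i]. *)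
Lemma Bmx_col1 i : i \notin sides P 0 -> (Bmx P q *m col 1 P) i 0 = 0.
Proof.
rewrite inE negb_or => /andP[/eqP i0 /eqP i1].
case: q_kkt => _ [_ /(_ i)[/(_ i0) l0 /(_ i1) r0 _ _]] _ /(_ i)[+ _].
rewrite l0 r0 subrr addr0 => E.
apply: (mulfI (_ : 2^-1 != 0 :> R)); first by rewrite invr_neq0 ?pnatr_eq0.
rewrite mulr0 -[RHS]E Bmx_mulE mulr_sumr; apply: eq_bigr => t _.
by rewrite partial_area0 mulrCA.
Qed.

Lemma Bmx_col0 i : i \notin sides P 1 -> (Bmx P q *m col 0 P) i 0 = 0.
Proof.
rewrite inE negb_or => /andP[/eqP i0 /eqP i1].
case: q_kkt => _ [_ /(_ i)[_ _ /(_ i0) l0 /(_ i1) r0]] _ /(_ i)[_ +].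
rewrite l0 r0 subrr addr0 => E.
apply: (mulfI (_ : - 2^-1 != 0 :> R)).
  by rewrite oppr_eq0 invr_neq0 ?pnatr_eq0.
rewrite mulr0 -[RHS]E Bmx_mulE mulr_sumr; apply: eq_bigr => t _.
by rewrite partial_area1 mulNr mulrN mulrCA.
Qed.

Lemma Bblock_skew b : (Bblock P q b)^T = - Bblock P q b.
Proof.
rewrite /Bblock linear_sum -sumrN; apply: eq_bigr => t _.
by rewrite linearZ /= Btri_skew scalerN.
Qed.

(** The sum is the pairing with the all-ones vector; skewness moves the matrix onto that vector,
    which every [Btri] annihilates. *)
Lemma sum_Bblock b w : \sum_i (Bblock P q b *m w) i 0 = 0.
Proof.
have -> : \sum_i (Bblock P q b *m w) i 0 = bform (Bblock P q b) (const_mx 1) w.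
  by rewrite /bform -mulmxA mxE; apply: eq_bigr => i _; rewrite !mxE mul1r.
rewrite bform_skew ?Bblock_skew // /bform -mulmxA.
suff -> : Bblock P q b *m (const_mx 1 : 'cV_n) = 0 by rewrite mulmx0 mxE oppr0.
rewrite /Bblock mulmx_suml big1 // => t _.
by rewrite -scalemxAl Btri_const scaler0.
Qed.

Lemma bform_block_gt0 b : 0 < min_area P -> (3 <= n)%N -> positive_block q b ->
  0 < bform (Bblock P q b) (col 0 P) (col 1 P).
Proof.
move=> P_pos n_ge3 [/set0Pn[t tb] pos _ _ _].
have -> : bform (Bblock P q b) (col 0 P) (col 1 P)
    = \sum_(t in triangles b) lam q t * (2 * area t P).
  rewrite /bform /Bblock mulmx_sumr mulmx_suml summxE; apply: eq_bigr => u _.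
  by rewrite -Btri_area -scalemxAr -scalemxAl mxE.
have term_gt0 u : u \in triangles b -> 0 < lam q u * (2 * area u P).
  by move=> /pos u_gt0; rewrite mulr_gt0 // mulr_gt0 ?ltr0n // area_gt0.
rewrite (bigD1 t) //= ltr_pwDl ?term_gt0 //.
by apply: sumr_ge0 => u /andP[/term_gt0/ltW].
Qed.

(** Only the terminal entries of the product can be nonzero, and they cancel because all entries sum
    to zero. *)
Lemma Bblock_dipole b w : positive_block q b -> internally_isolated q b ->
  (forall i, i \in internal b -> (Bmx P q *m w) i 0 = 0) ->
  exists rho, is_flux P q w b rho.
Proof.
move=> [_ _ ab disj verts] iso w0; set M := Bblock P q b.
have Mint i : i \in internal b -> (M *m w) i 0 = 0.
  (* At an internal vertex the block sum equals the full sum: a triangle outside the block has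
     weight zero or, by isolation, misses [i]. *)
  move=> iI; rewrite -(w0 i iI) Bmx_mulE Bblock_mulE big_mkcond /=.
  apply: eq_bigr => t _; case: ifPn => // tb.
  have [-> |lt0] := eqVneq (lam q t) 0; first by rewrite mul0r.
  have t_gt0 : 0 < lam q t.
    by rewrite lt0r lt0; case: q_kkt => -[+ _] _ _ _; apply.
  rewrite Btri_out ?mulr0 //.
  by rewrite (disjointFl (iso _ t_gt0 tb)).
have Mout i : i != term1 b -> i != term2 b -> (M *m w) i 0 = 0.
  move=> ia ib; have [/Mint //|iI] := boolP (i \in internal b).
  rewrite Bblock_mulE big1 // => t tb; rewrite Btri_out ?mulr0 //.
  have : i \notin (internal b :|: terminals b) by rewrite !inE !negb_or iI ia.
  by rewrite -verts; apply: contra => it; apply/bigcupP; exists t.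
exists ((M *m w) (term1 b) 0); apply/colP => i.
have := sum_Bblock b w; rewrite (bigD1 (term1 b)) //= (bigD1 (term2 b)) /=;
  last by rewrite eq_sym.
rewrite big1 ?addr0 => [/eqP|j /andP[ja jb]]; last exact: Mout.
rewrite addrC addr_eq0 => /eqP; rewrite -/M.
move: (M *m w) Mout => N Nout Nb; rewrite !mxE eqxx !andbT.
have [-> |ia] := eqVneq i (term1 b); first by rewrite (negPf ab) subr0 mulr1.
have [-> |ib] := eqVneq i (term2 b); first by rewrite sub0r mulrN1.
by rewrite subrr mulr0; exact: Nout.
Qed.

End Blocks.

(** Choosing a point of [S] in each [F k] gives an injection, by disjointness. *)
Lemma card_hitting_set (I T : finType) (F : I -> {set T}) (S : {set T}) :
  (forall k l, k != l -> [disjoint F k & F l]) ->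
  (forall k, ~~ [disjoint F k & S]) -> (#|I| <= #|S|)%N.
Proof.
move=> disj hit.
have hitP k : exists x, (x \in F k) && (x \in S).
  by have /pred0Pn[x xP] := hit k; exists x.
pose f k := xchoose (hitP k).
have fP k : (f k \in F k) && (f k \in S) := xchooseP (hitP k).
have f_inj : injective f.
  move=> k l fkl; apply/eqP; apply: contraT => /disj/disjointFr.
  have /andP[fk _] := fP k; have /andP[fl _] := fP l.
  by move=> /(_ _ fk); rewrite fkl fl.
rewrite -(card_codom f_inj); apply/subset_leq_card/fintype.subsetP.
by move=> _ /codomP[k ->]; have /andP[] := fP k.
Qed.

(** * Counting blocks by their internal boundary vertices *)

Theorem theorem7p6 (R : realType) (n : nat) (n_ge3 : (3 <= n)%N)
    (P : 'M[R]_(n, 2)) (P_opt : positive_local_optimum P)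
    (theta : multiplier R n) (theta_kkt : KKT P theta) :
  (forall (m : nat) (F : 'I_m -> block n),
     (forall k, positive_block theta (F k)) ->
     (forall k, internally_isolated theta (F k)) ->
     internally_disjoint F ->
     (m <= 8)%N)
  /\
  (forall (a b : 'I_n) (xi : 'cV[R]_n),
     a != b -> shared_kernel P xi ->
     forall (m : nat) (F : 'I_m -> block n),
     (forall k, positive_block theta (F k)) ->
     (forall k, internally_isolated theta (F k)) ->
     internally_disjoint F ->
     (forall k, terminals (F k) = [set a; b]%SET) ->
     (forall k, nonzero_flux P theta xi (F k)) ->
     (m <= 4)%N).

Proof.
have [_ _ P_pos] := P_opt.
have skM b := Bblock_skew P theta b.
split=> [m F posF isoF disjF|a b xi ab xi_sh m F posF isoF disjF termF fluxF].
  have cardS : (#|sides P 0%R :|: sides P 1%R| <= 8)%N.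
    apply: leq_trans (leq_card_setU _ _) _.
    exact: leq_add (card_sides n_ge3 P_pos 0) (card_sides n_ge3 P_pos 1).
  apply: leq_trans cardS; rewrite -[m in (m <= _)%N]card_ord.
  apply: (card_hitting_set disjF) => k; apply/negP => disjS.
  have intS i : i \in internal (F k) -> i \notin sides P 0 /\ i \notin sides P 1.
    by move=> /(disjointFr disjS); rewrite inE => /negbT; rewrite negb_or => /andP.
  have [|alpha Mx] := Bblock_dipole (w := col 0 P) theta_kkt (posF k) (isoF k).
    by move=> i /intS[_ i1]; exact: Bmx_col0.
  have [|beta My] := Bblock_dipole (w := col 1 P) theta_kkt (posF k) (isoF k).
    by move=> i /intS[i0 _]; exact: Bmx_col1.
  have := bform_block_gt0 P_pos n_ge3 (posF k).
  by rewrite (bform_dipole0 (skM _) Mx My) ltxx.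
(* Here [c] is a coordinate separating the terminals and [c'] the other one: [B(theta)] applied to
   column [c] vanishes off [sides P c'], which each block must therefore hit. *)
have bound (c c' : 'I_2) : P a c != P b c ->
    (forall i, i \notin sides P c' -> (Bmx P theta *m col c P) i 0 = 0) ->
    (m <= 4)%N.
  move=> neq_ab off_sides.
  apply: leq_trans (card_sides n_ge3 P_pos c'); rewrite -[m in (m <= _)%N]card_ord.
  apply: (card_hitting_set disjF) => k; apply/negP => disjS.
  have [|alpha Mz] := Bblock_dipole (w := col c P) theta_kkt (posF k) (isoF k).
    by move=> i /(disjointFr disjS)/negbT; exact: off_sides.
  have [rho Mxi rho0] := fluxF k.
  have := bform_dipole0 (skM _) Mz Mxi; rewrite (bform_dipole _ Mxi) => /eqP.
  rewrite mulf_eq0 (negPf rho0) subr_eq0 !mxE /= => /eqP eq12.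
  have [_ _ t12 _ _] := posF k.
  (* The terminals of a block may come in either order; both orders contradict [neq_ab], and the
     degenerate matchings contradict [ab]. *)
  have : (a \in terminals (F k)) && (b \in terminals (F k)).
    by rewrite termF !inE !eqxx orbT.
  rewrite !inE => /andP[/orP[]/eqP ea /orP[]/eqP eb];
    move: neq_ab ab; by rewrite ea eb ?eq12 eqxx.
(* The terminals are distinct points, so at least one coordinate separates them. *)
have [e0|ne0] := eqVneq (P a 0) (P b 0); last first.
  exact: (bound 0 1 ne0 (Bmx_col0 theta_kkt)).
apply: (bound 1 0 _ (Bmx_col1 theta_kkt)).
exact/eqP/(points_neq n_ge3 P_pos ab e0).
Qed.
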